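(* Let $\gamma\in(1,2]$ and $\mathbf U=(D,\mathbf m,E)^\top\in\mathcal G$. The NR-II method $$p_{n+1}=p_n-\frac{\psi(p_n)}{\psi'(p_n)},\qquad p_0=\begin{cases}0,&\text{if } D\ge \dfrac{E^2-|\mathbf m|^2}{E},\\ p_c^u,&\text{otherwise,}\end{cases}$$ is always PCP (that is, $p_n>0$ for all $n\ge 1$) and convergent (that is, $\lim_{n\to\infty}p_n=p(\mathbf U)$). Furthermore, it has quadratic convergence.
   Context: Let $d\ge 1$, $\gamma\in(1,2]$, and $\mathcal G=\{(D,\mathbf m,E)^\top: D\in\mathbb R,\ \mathbf m\in\mathbb R^d,\ E\in\mathbb R,\ D>0,\ E-\sqrt{D^2+|\mathbf m|^2}>0\}$. For $\mathbf U\in\mathcal G$ there is a unique triple $(\rho,\mathbf v,p)$ with $\rho>0$, $p>0$, $|\mathbf v|<1$ such that $D=\rho W$, $\mathbf m=DhW\mathbf v$, $E=DhW-p$, where $W=1/\sqrt{1-|\mathbf v|^2}$, $h=1+e+p/\rho$, $e=\frac{p}{(\gamma-1)\rho}$. The physical pressure $p(\mathbf U)$ is the component $p$ of this triple; it is the unique positive solution of $$\Phi(p):=\frac{p}{\gamma-1}-E+\frac{|\mathbf m|^2}{E+p}+D\sqrt{1-\frac{|\mathbf m|^2}{(E+p)^2}}=0 .$$ Define $$\psi(p)=(E+p)\Phi(p)=|\mathbf m|^2+(E+p)\Big(\frac{p}{\gamma-1}-E\Big)+D\sqrt{(E+p)^2-|\mathbf m|^2},$$ $$p_c^u=\frac{(\gamma-2)E+\sqrt{(2-\gamma)^2E^2-4(\gamma-1)\big[(|\mathbf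 m|^2-E^2)+D\sqrt{E^2-|\mathbf m|^2}\big]}}{2}.$$ Quadratic convergence is meant in the standard sense (order at least $2$): $p_n\to p(\mathbf U)$ and there is a constant $C$ with $|p_{n+1}-p(\mathbf U)|\le C|p_n-p(\mathbf U)|^2$ for all sufficiently large $n$. *)

(* Defs.v *)
From mathcomp Require Import all_boot all_order all_algebra.
From mathcomp Require Import all_classical all_reals all_analysis.

Set Implicit Arguments.
Unset Strict Implicit.
Unset Printing Implicit Defensive.

Import Order.TTheory GRing.Theory Num.Theory.
Import numFieldNormedType.Exports.

Local Open Scope classical_set_scope.
Local Open Scope ring_scope.

(* Squared Euclidean norm: the library's `|v| on 'rV[R]_d is the sup norm. *)
Definition sqnorm (R : realType) (d : nat) (v : 'rV[R]_d) : R :=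
  \sum_(i < d) v ord0 i ^+ 2.

Record cons_state (R : realType) (d : nat) := ConsState {
  density : R;
  momentum : 'rV[R]_d;
  energy : R
}.

Definition admissible (R : realType) (d : nat) : set (cons_state R d) :=
  [set U | 0 < density U /\
           0 < energy U - Num.sqrt (density U ^+ 2 + sqnorm (momentum U))].

Definition lorentz (R : realType) (d : nat) (v : 'rV[R]_d) : R :=
  1 / Num.sqrt (1 - sqnorm v).

Definition internal_energy (R : realType) (gamma rho p : R) : R :=
  p / ((gamma - 1) * rho).

Definition enthalpy (R : realType) (gamma rho p : R) : R :=
  1 + internal_energy gamma rho p + p / rho.

Definition cons_of_prim (R : realType) (d : nat) (gamma : R)
    (rho : R) (v : 'rV[R]_d) (p : R) : cons_state R d :=
  let W := lorentz v in
  let h := enthalpy gamma rho p in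
  let D := rho * W in
  ConsState D ((D * h * W) *: v) (D * h * W - p).

Definition prim_of_cons (R : realType) (d : nat) (gamma : R)
    (U : cons_state R d) : set (R * 'rV[R]_d * R) :=
  [set w | let: (rho, v, p) := w in
    [/\ 0 < rho, 0 < p, Num.sqrt (sqnorm v) < 1 &
        U = cons_of_prim gamma rho v p]].

(* The pressure component of the triple (rho, v, p) associated with U. The
   default value of xget is irrelevant when U is admissible, since the triple
   then exists and is unique. *)
Definition pressure (R : realType) (d : nat) (gamma : R)
    (U : cons_state R d) : R :=
  (xget (0, 0, 0) (prim_of_cons gamma U)).2.

Definition psi (R : realType) (d : nat) (gamma : R) (U : cons_state R d)
    (p : R) : R :=
  let D := density U in let m2 := sqnorm (momentum U) in let E := energy U in
  m2 + (E + p) * (p / (gamma - 1) - E) + D * Num.sqrt ((E + p) ^+ 2 - m2).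

Definition p_c_u (R : realType) (d : nat) (gamma : R) (U : cons_state R d) : R :=
  let D := density U in let m2 := sqnorm (momentum U) in let E := energy U in
  ((gamma - 2) * E
   + Num.sqrt ((2 - gamma) ^+ 2 * E ^+ 2
       - 4 * (gamma - 1) * ((m2 - E ^+ 2) + D * Num.sqrt (E ^+ 2 - m2)))) / 2.

Definition newton (R : realType) (f : R -> R) (x0 : R) (n : nat) : R :=
  iter n (fun x => x - f x / derive1 f x) x0.

Definition NR2_init (R : realType) (d : nat) (gamma : R)
    (U : cons_state R d) : R :=
  if (energy U ^+ 2 - sqnorm (momentum U)) / energy U <= density U
  then 0 else p_c_u gamma U.

(* For admissible U, psi is differentiable with psi' > 0 on [0, +oo[, so the
   total conventions for derive1 and for division by 0 never come into play as
   long as the iterates are nonnegative. *)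
Definition NR2 (R : realType) (d : nat) (gamma : R) (U : cons_state R d) :
    nat -> R :=
  newton (psi gamma U) (NR2_init gamma U).

Definition quadratic_cvg (R : realType) (u : nat -> R) (l : R) : Prop :=
  u @ \oo --> l /\
  exists C : R, \forall n \near \oo, `|u n.+1 - l| <= C * `|u n - l| ^+ 2.

(* Main.v *)
Require Import Defs.
From mathcomp Require Import all_boot all_order all_algebra.
From mathcomp Require Import all_classical all_reals all_analysis.
From mathcomp Require Import ring lra.
Import Order.TTheory GRing.Theory Num.Theory.
Import numFieldNormedType.Exports.
Local Open Scope classical_set_scope.
Local Open Scope ring_scope.

(* Put x = E + p, M = |m|^2, y = sqrt (x^2 - M) and let q be the positive root
   of psi.  The function psi has slopes at least D > 0 on [0, +oo[, hence q is
   unique, and it is the pressure.  Expanding psi at p with the remainder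
   K (q - p)^2, one Newton step N satisfies N p - q = K (p - q)^2 / psi'(p),
   where K, as a function of p, is bounded and nondecreasing.
   If K >= 0 at p = q, then no step overshoots q from the right; otherwise none
   overshoots it from the left.  The iterates thus end up on one side of q, where
   the error contracts geometrically since psi' is at most a constant times the
   slope of psi towards q; the error formula then gives the quadratic rate.
   Positivity: if D E < E^2 - M, every Newton step from p >= 0 is positive, because
   psi p < p psi' p; otherwise the iteration starts at 0 < q, and it is either
   trapped in [0, q] and increasing, or beyond q as soon as it passes q. *)

(** * Convergence of sequences that contract towards a point *)

Lemma cvg_of_contraction (R : realType) (u : nat -> R) (q c : R) (n0 : nat) :
  0 <= c < 1 ->
  (forall n, (n0 <= n)%N -> `|u n.+1 - q| <= c * `|u n - q|) ->
  u @ \oo --> q.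
Proof.
move=> /andP[c0 c1] hu.
have bnd n : `|u (n + n0)%N - q| <= `|u n0 - q| * c ^+ n.
  elim: n => [|n IH]; first by rewrite add0n expr0 mulr1.
  rewrite addSn (le_trans (hu _ (leq_addl _ _)))// exprS mulrCA.
  by rewrite ler_wpM2l.
rewrite -(cvg_shiftn n0).
have c_cvg : (fun n => `|u n0 - q| * c ^+ n) @ \oo --> (0 : R).
  rewrite -(mulr0 `|u n0 - q|); apply: cvgMr.
  by apply: cvg_expr; rewrite ger0_norm.
apply/cvgrPdist_le => e e0.
move/cvgrPdist_le/(_ e e0): c_cvg.
apply: filterS => n; rewrite sub0r normrN => hn.
by rewrite distrC (le_trans (bnd n))// (le_trans (ler_norm _)).
Qed.

(* Either the sequence eventually lies above [q], or it stays below [q]; in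
   both cases it no longer changes sides, hence contracts. *)
Lemma cvg_of_trapped_above (R : realType) (u : nat -> R) (q c : R) :
  0 <= c < 1 ->
  (forall n, 0 <= (u n.+1 - q) * (u n - q) ->
     `|u n.+1 - q| <= c * `|u n - q|) ->
  (forall n, q <= u n -> q <= u n.+1) ->
  u @ \oo --> q.
Proof.
move=> c01 contr up; have [[n0 qn0]|noup] := pselect (exists n, q <= u n).
  have qn k : q <= u (k + n0)%N by elim: k => // k; exact: up.
  apply: (@cvg_of_contraction _ _ _ _ n0 c01) => n n0n; apply: contr.
  by rewrite -(subnK n0n) mulr_ge0// subr_ge0// -addSn.
have qn k : u k < q by rewrite ltNge; apply/negP => ?; apply: noup; exists k.
apply: (@cvg_of_contraction _ _ _ _ 0%N c01) => n _; apply: contr.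
by rewrite mulr_le0// subr_le0 ltW.
Qed.

(** The reflection of [u] and [q] to [- u] and [- q] exchanges the two sides. *)
Lemma cvg_of_trapped_below (R : realType) (u : nat -> R) (q c : R) :
  0 <= c < 1 ->
  (forall n, 0 <= (u n.+1 - q) * (u n - q) ->
     `|u n.+1 - q| <= c * `|u n - q|) ->
  (forall n, u n <= q -> u n.+1 <= q) ->
  u @ \oo --> q.
Proof.
move=> c01 contr down; rewrite -[q]opprK.
have -> : u = (fun n => - - u n) by apply/funext => n; rewrite opprK.
apply: cvgN; apply: (@cvg_of_trapped_above _ _ _ c c01) => n.
  have nrm k : `|- u k - - q| = `|u k - q| by rewrite -opprD normrN.
  by rewrite -!opprD mulrNN !normrN; exact: contr.
by rewrite !lerN2; exact: down.
Qed.

(** * Elementary bounds and first divided differences of [psi] *)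

Section PressureFunction.
(* [a] is [1 / (gamma - 1)], so that [F] below is [psi gamma U]. *)
Variables (R : realType) (a D E M : R).
Hypotheses (a1 : 1 <= a) (D0 : 0 < D) (M0 : 0 <= M) (E0 : 0 < E).
Hypothesis DME : D ^+ 2 + M < E ^+ 2.

Implicit Types p q : R.

Let x (p : R) : R := E + p.
Let y (p : R) : R := Num.sqrt (x p ^+ 2 - M).
Let F (p : R) : R := M + x p * (p * a - E) + D * y p.
Let F' (p : R) : R := 2 * a * x p - (a + 1) * E + D * (x p / y p).
Let N (p : R) : R := p - F p / F' p.

Lemma a_ge0 : 0 <= a. Proof. exact: le_trans ler01 a1. Qed.

Lemma x_gt0 p : 0 <= p -> 0 < x p. Proof. by have := E0; rewrite /x; lra. Qed.

Lemma sqr_y_gt p : 0 <= p -> D ^+ 2 < x p ^+ 2 - M.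
Proof. by have := E0; have := DME; rewrite /x; nra. Qed.

Lemma sqr_y p : 0 <= p -> y p ^+ 2 = x p ^+ 2 - M.
Proof.
by move=> /sqr_y_gt h; rewrite sqr_sqrtr// (le_trans (sqr_ge0 D))// ltW.
Qed.

Lemma y_gtD p : 0 <= p -> D < y p.
Proof.
move=> /sqr_y_gt h; rewrite -(ger0_norm (ltW D0)) -sqrtr_sqr ltr_sqrt//.
by rewrite (le_lt_trans (sqr_ge0 D)).
Qed.

Lemma y_gt0 p : 0 <= p -> 0 < y p.
Proof. by move=> /y_gtD; exact: lt_trans. Qed.

Lemma y_ge0 p : 0 <= p -> 0 <= y p. Proof. by move=> /y_gt0/ltW. Qed.

Lemma x_ge0 p : 0 <= p -> 0 <= x p. Proof. by move=> /x_gt0/ltW. Qed.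

Lemma y_le_x p : 0 <= p -> y p <= x p.
Proof.
move=> p0; rewrite -ler_sqr ?nnegrE ?y_ge0 ?x_ge0//.
by rewrite sqr_y// gerBl.
Qed.

Lemma y_mono p p' : 0 <= p -> p <= p' -> y p <= y p'.
Proof.
move=> p0 pp'; have p'0 := le_trans p0 pp'.
rewrite -ler_sqr ?nnegrE ?y_ge0// !sqr_y// /x; have := E0; nra.
Qed.

(** The maximum of x / y over p >= 0: as x / y = 1 / sqrt (1 - M / x^2) is nonincreasing in p, it is
    reached at p = 0. *)
Let kappa : R := E / y 0.

Lemma x_le_y p : 0 <= p -> x p <= kappa * y p.
Proof.
move=> p0; have s0 := y_gt0 0 (lexx 0); have yp0 := y_gt0 p p0.
rewrite /kappa mulrAC ler_pdivlMr//.
rewrite -ler_sqr ?nnegrE ?mulr_ge0 ?x_ge0 ?y_ge0 ?(ltW E0)//.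
rewrite !exprMn !sqr_y// /x.
have : 0 <= M * (p * (2 * E + p)).
  by rewrite !mulr_ge0 ?addr_ge0 ?mulr_ge0 ?(ltW E0).
nra.
Qed.

Lemma kappa_ge1 : 1 <= kappa.
Proof.
by rewrite /kappa ler_pdivlMr ?y_gt0// mul1r -[leRHS]addr0 y_le_x.
Qed.

(* Divided difference of [F], using
   [y p - y q = (x p ^+ 2 - x q ^+ 2) / (y p + y q)]. *)
Let slope p q : R := a * (x p + x q) - (a + 1) * E + D * ((x p + x q) / (y p + y q)).

Lemma slopeP p q : 0 <= p -> 0 <= q -> F p - F q = slope p q * (p - q).
Proof.
move=> p0 q0; rewrite /F /slope.
have yp0 := y_gt0 p p0; have yq0 := y_gt0 q q0.
have h : (x p + x q) / (y p + y q) * (p - q) = y p - y q.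
  rewrite mulrAC; apply: (canLR (mulfK _)); first by rewrite gt_eqF ?addr_gt0.
  have := sqr_y p p0; have := sqr_y q q0; rewrite /x; nra.
rewrite [in RHS]mulrDl -[D * _ * _]mulrA h /x; ring.
Qed.

Lemma ratio_ge1 p q : 0 <= p -> 0 <= q -> 1 <= (x p + x q) / (y p + y q).
Proof.
move=> p0 q0; rewrite ler_pdivlMr ?addr_gt0 ?y_gt0// mul1r.
by rewrite lerD// y_le_x.
Qed.

Lemma ratio_le p q : 0 <= p -> 0 <= q -> (x p + x q) / (y p + y q) <= kappa.
Proof.
move=> p0 q0; rewrite ler_pdivrMr ?addr_gt0 ?y_gt0// mulrDr.
by rewrite lerD// x_le_y.
Qed.

(** Since x p + x q = 2 E + p + q, the polynomial part is (a - 1) E + a (p + q), nonnegative because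
    a >= 1, that is gamma <= 2; the ratio multiplying [D] is at least 1. *)
Lemma slope_ge p q : 0 <= p -> 0 <= q -> D <= slope p q.
Proof.
move=> p0 q0; have := ratio_ge1 p q p0 q0; rewrite /slope.
set r := (_ / _) => r1.
have aE : 0 <= (a - 1) * E by rewrite mulr_ge0 ?subr_ge0 ?(ltW E0).
have apq : 0 <= a * (p + q) by rewrite mulr_ge0 ?a_ge0 ?addr_ge0.
have Dr : 0 <= D * (r - 1) by rewrite mulr_ge0 ?subr_ge0 ?(ltW D0).
by rewrite /x; lra.
Qed.

Lemma F'E p : 0 <= p -> F' p = slope p p.
Proof.
move=> p0; rewrite /F' /slope; have := y_gt0 p p0 => yp0.
by field; rewrite !gt_eqF// addr_gt0.
Qed.

Lemma F'_ge p : 0 <= p -> D <= F' p.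
Proof. by move=> p0; rewrite F'E// slope_ge. Qed.

(** Twice the slope covers the polynomial part of [F' p], and [kappa] times the slope covers D x /
    y. A Newton step therefore makes up at least a fixed fraction of the distance to the root. *)
Lemma F'_le_slope p q : 0 <= p -> 0 <= q -> F' p <= (2 + kappa) * slope p q.
Proof.
move=> p0 q0; rewrite mulrDl.
have h1 := ratio_ge1 p q p0 q0.
have h2 : D * kappa <= kappa * slope p q.
  by rewrite mulrC ler_wpM2l ?slope_ge// (le_trans ler01) ?kappa_ge1.
have h3 : x p / y p <= kappa by rewrite ler_pdivrMr ?y_gt0// x_le_y.
apply: (le_trans _ (lerD (lexx _) h2)).
rewrite /F' /slope; set r := x p / y p in h3 *.
set r' := (x p + x q) / (y p + y q) in h1 *.
have aE : 0 <= (a - 1) * E by rewrite mulr_ge0 ?subr_ge0 ?(ltW E0).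
have aq : 0 <= a * q by rewrite mulr_ge0 ?a_ge0.
have Dr : 0 <= D * (kappa - r) by rewrite mulr_ge0 ?subr_ge0 ?(ltW D0).
have Dr' : 0 <= D * r' by rewrite mulr_ge0 ?(ltW D0) ?(le_trans ler01 h1).
by rewrite /x; lra.
Qed.

(** * The second-order remainder and its monotonicity *)

(* [K p q := a - T p q] is the divided difference of [F] at the nodes [p, p, q];
   [T] is written as a product of factors that are nonincreasing in [p]. *)
Let T p q : R := D / y p * (M / (M + x p * x q + y p * y q)) *
  ((x p + x q) / (y p + y q)) ^+ 2.

Let K p q : R := a - T p q.

Lemma T_den_gt0 p q : 0 <= p -> 0 <= q -> 0 < M + x p * x q + y p * y q.
Proof.
move=> p0 q0; rewrite addr_gt0 ?mulr_gt0 ?x_gt0 ?y_gt0//.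
by rewrite ltr_wpDl ?mulr_gt0 ?x_gt0.
Qed.

(** The quadratic part of [F] leaves the remainder a (q - p)^2, and the concave term D y leaves - T
    (q - p)^2. *)
Lemma F_expansion p q : 0 <= p -> 0 <= q ->
  F q = F p + F' p * (q - p) + K p q * (q - p) ^+ 2.
Proof.
move=> p0 q0; have yp0 := y_gt0 p p0; have yq0 := y_gt0 q q0.
have den0 := T_den_gt0 p q p0 q0.
have sp := sqr_y p p0; have sq := sqr_y q q0.
have h : (x p + x q) / (y p + y q) * (q - p) = y q - y p.
  rewrite mulrAC; apply: (canLR (mulfK _)); first by rewrite gt_eqF ?addr_gt0.
  rewrite /x in sp sq *; nra.
(* From (x p x q)^2 - (M + y p y q)^2 = M (y q - y p)^2, after factoring the left side. *)
have h2 : M / (M + x p * x q + y p * y q) * (y q - y p) ^+ 2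
    = x p * x q - M - y p * y q.
  rewrite mulrAC; apply: (canLR (mulfK _)); first by rewrite gt_eqF.
  rewrite /x in sp sq *; nra.
have h3 : T p q * (q - p) ^+ 2 = D / y p * (x p * x q - M - y p * y q).
  by rewrite /T -mulrA -exprMn h -mulrA h2.
rewrite /K mulrBl h3 /F /F'.
have -> : M = x p ^+ 2 - y p ^+ 2 by rewrite sp; ring.
rewrite /x; field; exact: lt0r_neq0.
Qed.

Lemma T_ge0 p q : 0 <= p -> 0 <= q -> 0 <= T p q.
Proof.
move=> p0 q0; rewrite /T mulr_ge0 ?sqr_ge0// mulr_ge0//.
  by rewrite divr_ge0 ?(ltW D0) ?ltW ?y_gt0.
by rewrite divr_ge0// ltW// T_den_gt0.
Qed.

Lemma T_le p q : 0 <= p -> 0 <= q -> T p q <= kappa ^+ 2.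
Proof.
move=> p0 q0; have yp0 := y_gt0 p p0.
have h1 : 0 <= D / y p <= 1.
  apply/andP; split; first by rewrite divr_ge0 ?(ltW D0) ?(ltW yp0).
  by rewrite ler_pdivrMr// mul1r ltW// y_gtD.
have d0 := T_den_gt0 p q p0 q0.
have h2 : 0 <= M / (M + x p * x q + y p * y q) <= 1.
  apply/andP; split; first by rewrite divr_ge0 ?(ltW d0).
  by rewrite ler_pdivrMr// mul1r -addrA lerDl addr_ge0 ?mulr_ge0 ?x_ge0 ?y_ge0.
have h3 := ratio_ge1 p q p0 q0; have h4 := ratio_le p q p0 q0.
rewrite /T -[leRHS]mul1r ler_pM ?sqr_ge0//.
- by case/andP: h1 => ? _; case/andP: h2 => ? _; rewrite mulr_ge0.
- by case/andP: h1 => ? ?; case/andP: h2 => ? ?; rewrite mulr_ile1.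
- by rewrite ler_sqr ?nnegrE// (le_trans ler01)// (le_trans h3).
Qed.

Lemma K_norm_le p q : 0 <= p -> 0 <= q -> `|K p q| <= a + kappa ^+ 2.
Proof.
move=> p0 q0; have := T_ge0 p q p0 q0; have := T_le p q p0 q0.
rewrite ler_norml /K; have := a1; lra.
Qed.

Lemma T_anti p p' q : 0 <= p -> p <= p' -> 0 <= q -> T p' q <= T p q.
Proof.
move=> p0 pp' q0; have p'0 := le_trans p0 pp'.
have yy := y_mono p p' p0 pp'.
have xx : x p <= x p' by rewrite lerD2l.
have yp0 := y_gt0 p p0; have yp'0 := y_gt0 p' p'0; have yq0 := y_gt0 q q0.
have xp0 := x_gt0 p p0; have xp'0 := x_gt0 p' p'0; have xq0 := x_gt0 q q0.
have d0 := T_den_gt0 p q p0 q0; have d'0 := T_den_gt0 p' q p'0 q0.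
have r0 : 0 <= (x p' + x q) / (y p' + y q).
  by rewrite (le_trans ler01)// ratio_ge1.
rewrite /T ler_pM ?sqr_ge0//.
- by rewrite !mulr_ge0 ?invr_ge0 ?(ltW D0) ?(ltW yp'0) ?(ltW d'0).
- rewrite ler_pM ?divr_ge0 ?(ltW D0) ?(ltW yp'0) ?(ltW d'0)//.
    by rewrite ler_wpM2l ?(ltW D0)// lef_pV2.
  rewrite ler_wpM2l// lef_pV2// -!addrA lerD2l lerD//.
    by rewrite ler_wpM2r// ltW.
  by rewrite ler_wpM2r// ltW.
- rewrite ler_sqr ?nnegrE//; last first.
    by rewrite (le_trans ler01)// ratio_ge1.
  (* Cross-multiplied, the inequality is the sum of [h1] (x / y decreases along the hyperbola x^2 -
     y^2 = M) and [h4] (y grows at least as fast as x, and y q <= x q). *)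
  rewrite ler_pdivrMr ?addr_gt0// mulrAC ler_pdivlMr ?addr_gt0//.
  have sp := sqr_y p p0; have sp' := sqr_y p' p'0.
  have yxq := y_le_x q q0; have yxp := y_le_x p p0; have yxp' := y_le_x p' p'0.
  have h2 : (x p' - x p) * (x p' + x p) = (y p' - y p) * (y p' + y p).
    by rewrite -!subr_sqr sp sp'; ring.
  have h3 : x p' - x p <= y p' - y p.
    rewrite -(ler_pM2r (addr_gt0 xp'0 xp0)) h2 ler_wpM2l ?subr_ge0//.
    by rewrite lerD.
  have h4 : (x p' - x p) * y q <= (y p' - y p) * x q.
    by rewrite ler_pM ?subr_ge0 ?(ltW yq0).
  have h1 : x p' * y p <= x p * y p'.
    rewrite -ler_sqr ?nnegrE ?mulr_ge0 ?x_ge0 ?y_ge0// !exprMn sp sp'.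
    rewrite !mulrBr [x p' ^+ 2 * _]mulrC lerD2l lerN2 ler_wpM2r//.
    by rewrite ler_sqr ?nnegrE ?x_ge0.
  by lra.
Qed.

Lemma K_mono p p' q : 0 <= p -> p <= p' -> 0 <= q -> K p q <= K p' q.
Proof. by move=> *; rewrite /K lerD2l lerN2 T_anti. Qed.


(** * The derivative of [psi] and its positive root *)

Lemma is_derive_F p : 0 <= p -> is_derive p 1 F (F' p).
Proof.
move=> p0; have yp0 := y_gt0 p p0.
have arg0 : 0 < x p ^+ 2 - M by rewrite -sqr_y// exprn_gt0.
have dx : is_derive p 1 (cst E + id : R -> R) 1.
  by apply: is_derive_eq; rewrite add0r.
have dsq : is_derive p 1 ((cst E + id : R -> R) ^+ 2 - cst M) (2 * x p).
  by apply: is_derive_eq; rewrite subr0 expr1 /GRing.scale/= mulr1.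
have dy : is_derive p 1 y (x p / y p).
  have := @is_derive1_comp _ (@Num.sqrt R) ((cst E + id : R -> R) ^+ 2 - cst M) p
    _ _ (is_derive1_sqrt arg0) dsq.
  move=> h; apply: (is_derive_eq h).
  by rewrite -/(y p); field; rewrite gt_eqF.
have -> : F = cst M + (cst E + id : R -> R) * (a *: id - cst E) + D *: y.
  by apply/funext => t; rewrite /F [t * a]mulrC.
have dlin : is_derive p 1 (a *: id - cst E : R -> R) a.
  by apply: is_derive_eq; rewrite subr0 /GRing.scale/= mulr1.
apply: (is_derive_eq (is_deriveD (is_deriveD (is_derive_cst M p 1)
  (is_deriveM dx dlin)) (is_deriveZ D dy))).
transitivity ((E + p) * a + (a * p - E) + D * (x p / y p)).
  by rewrite add0r /GRing.scale/= !mulr1.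
by rewrite /F' /x; ring.
Qed.

Lemma derive1_F p : 0 <= p -> derive1 F p = F' p.
Proof.
by move=> p0; rewrite derive1E; have h := is_derive_F p p0; exact: derive_val.
Qed.

Lemma F0_lt0 : F 0 < 0.
Proof.
have sD := y_gtD 0 (lexx 0); have s0 := y_gt0 0 (lexx 0).
have -> : F 0 = - (y 0 * (y 0 - D)).
  by rewrite mulrBr -expr2 sqr_y// /F /x; ring.
by rewrite oppr_lt0 mulr_gt0 ?subr_gt0.
Qed.

Lemma F_has_root : exists2 q, 0 < q & F q = 0.
Proof.
(* The endpoint [E] is large enough: F E = M + 2 E^2 (a - 1) + D y E > 0. *)
have [|||q qE Fq] := @IVT R F 0 E 0.
- exact: ltW.
- apply: derivable_within_continuous => p; rewrite in_itv/= => /andP[p0 _].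
  by have h := is_derive_F p p0; exact: ex_derive.
- have FE : 0 < F E.
    have -> : F E = M + 2 * E ^+ 2 * (a - 1) + D * y E by rewrite /F /x; ring.
    rewrite ltr_wpDl ?mulr_gt0 ?y_gt0 ?(ltW E0)//.
    by rewrite addr_ge0// mulr_ge0 ?subr_ge0// mulr_ge0 ?sqr_ge0.
  have F0 := F0_lt0.
  by rewrite minElt maxElt (lt_trans F0 FE) !ltW.
exists q => //; move: qE; rewrite in_itv/= le_eqVlt => /andP[/orP[/eqP q0|//] _].
by have := F0_lt0; rewrite [X in F X]q0 Fq ltxx.
Qed.

Lemma F_root_unique p q : 0 <= p -> 0 <= q -> F p = 0 -> F q = 0 -> p = q.
Proof.
move=> p0 q0 Fp Fq; apply/eqP; rewrite -subr_eq0.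
have := slopeP p q p0 q0; rewrite Fp Fq subrr => /esym/eqP.
by rewrite mulf_eq0 gt_eqF// (lt_le_trans D0)// slope_ge.
Qed.

(** * The error of a Newton step, and convergence *)

Lemma F'_gt0 p : 0 <= p -> 0 < F' p.
Proof. by move=> p0; exact: lt_le_trans D0 (F'_ge p p0). Qed.

Lemma slope_gt0 p q : 0 <= p -> 0 <= q -> 0 < slope p q.
Proof. by move=> p0 q0; exact: lt_le_trans D0 (slope_ge p q p0 q0). Qed.

Lemma newton_err p q : 0 <= p -> 0 <= q -> F q = 0 ->
  N p - q = K p q / F' p * (p - q) ^+ 2.
Proof.
move=> p0 q0 Fq; have := F_expansion p q p0 q0; rewrite Fq => h.
have F'0 := F'_gt0 p p0.
have -> : K p q / F' p * (p - q) ^+ 2 = K p q * (q - p) ^+ 2 / F' p by ring.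
have -> : K p q * (q - p) ^+ 2 = - F p - F' p * (q - p).
  by apply/eqP; rewrite -subr_eq0 [X in _ == X]h; apply/eqP; ring.
by rewrite /N; field; rewrite gt_eqF.
Qed.

(** The first-order form of the error, which drives the contraction; [newton_err] is the
    second-order form, which gives the sides and the rate. *)
Lemma newton_ratio p q : 0 <= p -> 0 <= q -> F q = 0 ->
  N p - q = (1 - slope p q / F' p) * (p - q).
Proof.
move=> p0 q0 Fq; rewrite /N.
have -> : F p = slope p q * (p - q) by rewrite -slopeP// Fq subr0.
ring.
Qed.

(** The fraction of the distance to the root that each step is sure to cover. *)
Let lam : R := (2 + kappa)^-1.

Lemma lam_itv : 0 < lam <= 1.
Proof.
have k2 : 0 < 2 + kappa by have := kappa_ge1; lra.
rewrite /lam invr_gt0 k2/= invf_le1//; have := kappa_ge1; lra.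
Qed.

(** Staying on one side of [q] means that the factor 1 - slope / F' is nonnegative, so the upper
    bound 1 - [lam] also bounds its absolute value. *)
Lemma newton_contr p q : 0 <= p -> 0 <= q -> F q = 0 ->
  0 <= (N p - q) * (p - q) -> `|N p - q| <= (1 - lam) * `|p - q|.
Proof.
move=> p0 q0 Fq; rewrite newton_ratio// normrM -mulrA -expr2.
have [->|pq] := eqVneq p q; first by rewrite subrr normr0 !mulr0.
rewrite pmulr_lge0 ?exprn_even_gt0 ?subr_eq0// => r1.
rewrite ler_wpM2r// ger0_norm// lerD2l lerN2.
rewrite ler_pdivlMr ?F'_gt0// /lam mulrC ler_pdivrMr.
  by rewrite mulrC F'_le_slope.
by have := kappa_ge1; lra.
Qed.

Lemma newton_incr p q : 0 <= p -> p < q -> F q = 0 -> p < N p.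
Proof.
move=> p0 pq Fq; have q0 : 0 <= q by rewrite (le_trans p0) ?ltW.
rewrite /N ltrDl oppr_gt0 pmulr_llt0 ?invr_gt0 ?F'_gt0//.
have -> : F p = slope p q * (p - q) by rewrite -slopeP// Fq subr0.
by rewrite pmulr_rlt0 ?slope_gt0// subr_lt0.
Qed.

(** For p different from [q], N p - q has the sign of [K p q]; as [K] is nondecreasing in p, its
    sign at [q] persists on one side of [q]. *)
Lemma newton_trapped q : 0 <= q -> F q = 0 ->
  (forall p, q <= p -> q <= N p) \/ (forall p, 0 <= p -> p <= q -> N p <= q).
Proof.
move=> q0 Fq; have [Kq|Kq] := lerP 0 (K q q); [left|right].
  move=> p qp; have p0 := le_trans q0 qp.
  rewrite -subr_ge0 newton_err// mulr_ge0 ?sqr_ge0// divr_ge0 ?(ltW (F'_gt0 _ _))//.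
  by rewrite (le_trans Kq)// K_mono.
move=> p p0 pq; rewrite -subr_le0 newton_err// mulr_le0_ge0 ?sqr_ge0//.
rewrite mulr_le0_ge0 ?invr_ge0 ?(ltW (F'_gt0 _ _))//.
by rewrite (le_trans (K_mono p q q p0 pq q0))// ltW.
Qed.

Lemma newton_cvg q (u : nat -> R) : 0 <= q -> F q = 0 ->
  (forall n, 0 <= u n) -> (forall n, u n.+1 = N (u n)) ->
  quadratic_cvg u q.
Proof.
move=> q0 Fq u0 uN; have lam01 := lam_itv; split.
  have contr n : 0 <= (u n.+1 - q) * (u n - q) ->
      `|u n.+1 - q| <= (1 - lam) * `|u n - q|.
    by rewrite uN; exact: newton_contr.
  have c01 : 0 <= 1 - lam < 1 by lra.
  have [h|h] := newton_trapped q q0 Fq.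
    by apply: (cvg_of_trapped_above R u q (1 - lam) c01 contr) => n; rewrite uN; exact: h.
  by apply: (cvg_of_trapped_below R u q (1 - lam) c01 contr) => n; rewrite uN; exact: h.
(* The bound on |K| over the lower bound [D] on [F']. *)
exists ((a + kappa ^+ 2) / D); apply: nearW => n.
rewrite uN newton_err// normrM normrX ler_wpM2r ?sqr_ge0//.
rewrite normrM ler_pM// ?K_norm_le// normfV lef_pV2 ?posrE ?normr_gt0 ?gt_eqF ?F'_gt0//.
by rewrite (le_trans (F'_ge (u n) _)) ?ler_norm.
Qed.

(** * Positivity of the iterates *)

Lemma newton_pos_of_density_lt p : D * E < E ^+ 2 - M -> 0 <= p -> 0 < N p.
Proof.
move=> hD p0; have yp0 := y_gt0 p p0; have sp := sqr_y p p0.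
rewrite /N subr_gt0 ltr_pdivrMr ?F'_gt0//.
(* Since p x - y^2 = - w, the square-root terms of p F' p - F p sum to - D w / y. The bound w <= y E
   rests on (y E)^2 - w^2 = (E^2 - S) (S + 2 E p), and yields D w / y <= D E < S. *)
pose S := E ^+ 2 - M; pose w := S + E * p.
have S0 : 0 < S by rewrite (le_lt_trans _ hD) ?mulr_ge0 ?ltW.
have Ep : 0 <= E * p by rewrite mulr_ge0 ?(ltW E0).
have w0 : 0 < w by rewrite ltr_wpDr.
have SE : S <= E ^+ 2 by rewrite gerBl.
have wy : w <= y p * E.
  rewrite -ler_sqr ?nnegrE ?mulr_ge0 ?(ltW w0) ?(ltW yp0) ?(ltW E0)//.
  rewrite exprMn sp.
  have h1 : 0 <= (E ^+ 2 - S) * (S + 2 * (E * p)).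
    apply: mulr_ge0; first by rewrite subr_ge0.
    by apply: addr_ge0; [exact: ltW | exact: mulr_ge0].
  by rewrite /x /w; rewrite /S in h1 *; lra.
have Dw : D * (w / y p) < S.
  rewrite mulrA ltr_pdivrMr// -(ltr_pM2r E0) mulrAC.
  rewrite (@lt_le_trans _ _ (S * w)) ?ltr_pM2r//.
  by rewrite -mulrA ler_wpM2l ?(ltW S0).
rewrite -subr_gt0.
have -> : p * F' p - F p = a * p ^+ 2 + (S - D * (w / y p)).
  have hM : M = x p ^+ 2 - y p ^+ 2 by rewrite sp; ring.
  rewrite /F' /F /w /S hM /x; field; exact: lt0r_neq0.
by rewrite ltr_wpDl ?subr_gt0// mulr_ge0 ?a_ge0 ?sqr_ge0.
Qed.

(** The recursion is assumed at nonnegative iterates only, where the formula [F'] for the derivative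
    is available; hence the induction carries the sign along. *)
Lemma newton_pos_from0 q (u : nat -> R) : 0 < q -> F q = 0 -> u 0%N = 0 ->
  (forall n, 0 <= u n -> u n.+1 = N (u n)) ->
  forall n, 0 <= u n /\ 0 < u n.+1.
Proof.
move=> q0 Fq u0 uN; have [h|h] := newton_trapped q (ltW q0) Fq.
  have pos p : 0 <= p -> 0 < N p.
    move=> p0; have [qp|pq] := lerP q p; first exact: lt_le_trans q0 (h p qp).
    exact: le_lt_trans p0 (newton_incr p q p0 pq Fq).
  elim=> [|n [_ un1]]; first by rewrite uN u0// pos.
  by have un0 := ltW un1; split; rewrite // uN// pos.
have step p : 0 <= p -> p <= q -> [/\ 0 < N p & N p <= q].
  move=> p0 pq; split; last exact: h.
  move: pq; rewrite le_eqVlt => /orP[/eqP ->|pq].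
    by rewrite /N Fq mul0r subr0.
  exact: le_lt_trans p0 (newton_incr p q p0 pq Fq).
suff bnd n : 0 <= u n /\ u n <= q.
  by move=> n; have [un0 unq] := bnd n; rewrite uN//; have [] := step _ un0 unq.
elim: n => [|n [un0 unq]]; first by rewrite u0; split=> //; exact: ltW.
by rewrite uN//; have [/ltW] := step _ un0 unq.
Qed.

End PressureFunction.

(** * From conserved to primitive variables: the pressure as the root of [psi] *)

Lemma sqnormZ (R : realType) (d : nat) (c : R) (v : 'rV[R]_d) :
  sqnorm (c *: v) = c ^+ 2 * sqnorm v.
Proof.
by rewrite /sqnorm mulr_sumr; apply: eq_bigr => i _; rewrite !mxE exprMn.
Qed.

Lemma sqnorm_ge0 (R : realType) (d : nat) (v : 'rV[R]_d) : 0 <= sqnorm v.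
Proof. by rewrite /sqnorm sumr_ge0// => i _; exact: sqr_ge0. Qed.

Section Pressure.
Variables (R : realType) (d : nat) (gamma : R) (U : cons_state R d).
Hypotheses (gamma12 : 1 < gamma <= 2) (U_adm : admissible U).

Let D := density U.
Let E := energy U.
Let M := sqnorm (momentum U).

Lemma adm_density_gt0 : 0 < D. Proof. by case: U_adm. Qed.

Lemma adm_energy_gt0 : 0 < E.
Proof.
by case: U_adm => _; rewrite subr_gt0; apply: le_lt_trans; exact: sqrtr_ge0.
Qed.

Lemma adm_energy_sqr : D ^+ 2 + M < E ^+ 2.
Proof.
case: U_adm => _; rewrite subr_gt0 => h.
have DM0 : 0 <= D ^+ 2 + M by rewrite addr_ge0 ?sqr_ge0 ?sqnorm_ge0.
by rewrite -(sqr_sqrtr DM0) ltr_sqr ?nnegrE ?sqrtr_ge0 ?(ltW adm_energy_gt0).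
Qed.

Lemma inv_gamma1_ge1 : 1 <= (gamma - 1)^-1.
Proof.
by have /andP[g1 g2] := gamma12; rewrite invf_ge1 ?subr_gt0// lerBlDr.
Qed.

Lemma psi_of_prim rho v p :
  prim_of_cons gamma U (rho, v, p) -> psi gamma U p = 0.
Proof.
case=> rho0 p0 v1 UE; have /andP[g1 _] := gamma12.
have v21 : sqnorm v < 1.
  by rewrite -(sqr_sqrtr (sqnorm_ge0 R d v)) expr_lt1 ?sqrtr_ge0.
pose t := Num.sqrt (1 - sqnorm v).
have t0 : 0 < t by rewrite sqrtr_gt0 subr_gt0.
have t2 : t ^+ 2 = 1 - sqnorm v by rewrite sqr_sqrtr// subr_ge0 ltW.
have WE : lorentz v = t^-1 by rewrite /lorentz div1r.
pose h := enthalpy gamma rho p.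
have h0 : 0 < h.
  rewrite /h /enthalpy /internal_energy -addrA ltr_wpDr// addr_ge0//.
    by rewrite divr_ge0 ?mulr_ge0 ?subr_ge0 ?ltW.
  by rewrite divr_ge0 ?ltW.
(* [X] is D h W = E + p and [t] is 1 / W, so the square root in [psi] is X t, and [psi] factors as X
   (rho h - X t^2), which is 0. *)
pose X := rho * t^-1 * h * t^-1.
have X0 : 0 < X by rewrite !mulr_gt0 ?invr_gt0.
rewrite UE /psi /cons_of_prim WE -/h -/X /= sqnormZ subrK.
have -> : X ^+ 2 - X ^+ 2 * sqnorm v = (X * t) ^+ 2.
  by rewrite [RHS]exprMn t2 mulrBr mulr1.
rewrite sqrtr_sqr (ger0_norm (ltW (mulr_gt0 X0 t0))).
have -> : sqnorm v = 1 - t ^+ 2 by rewrite t2 subKr.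
have Xt : X * t ^+ 2 = rho + (p / (gamma - 1) + p).
  rewrite /X /h /enthalpy /internal_energy; field.
  by rewrite !gt_eqF ?subr_gt0.
transitivity (X * (rho + (p / (gamma - 1) + p) - X * t ^+ 2)); last first.
  by rewrite Xt subrr mulr0.
by field; rewrite !gt_eqF ?subr_gt0.
Qed.

(** Recovery by v = m / (E + p), W = x / y and rho = D / W; the equation psi = 0 then says D h W = E
    + p. *)
Lemma prim_exists p : 0 < p -> psi gamma U p = 0 ->
  exists w, prim_of_cons gamma U w.
Proof.
move=> p0 psi0; have /andP[g1 _] := gamma12.
pose x := E + p.
have x0 : 0 < x by rewrite addr_gt0// adm_energy_gt0.
have D0 := adm_density_gt0.
have arg0 : 0 < x ^+ 2 - M.
  rewrite subr_gt0 (le_lt_trans _ (lt_trans adm_energy_sqr _))//.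
    by rewrite lerDr sqr_ge0.
  by rewrite ltr_sqr ?nnegrE ?(ltW x0) ?(ltW adm_energy_gt0)// ltrDl.
pose y := Num.sqrt (x ^+ 2 - M).
have y0 : 0 < y by rewrite sqrtr_gt0.
have y2 : y ^+ 2 = x ^+ 2 - M by rewrite sqr_sqrtr// ltW.
pose v := x^-1 *: momentum U.
have vE : sqnorm v = 1 - (y / x) ^+ 2.
  rewrite /v sqnormZ -/M expr_div_n y2; field; exact: lt0r_neq0.
have WE : lorentz v = x / y.
  rewrite /lorentz vE subKr sqrtr_sqr ger0_norm ?divr_ge0 ?ltW//.
  by rewrite div1r invf_div.
pose rho := D * (y / x).
have rho0 : 0 < rho by rewrite !mulr_gt0 ?invr_gt0.
exists (rho, v, p); split=> //.
  rewrite -[ltRHS]sqrtr1 ltr_sqrt// vE ltrBlDr ltrDl.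
  by rewrite exprn_gt0// divr_gt0.
rewrite /cons_of_prim WE.
have -> : rho * (x / y) = D by rewrite /rho; field; rewrite !gt_eqF.
have -> : D * enthalpy gamma rho p * (x / y) = x.
  have key : D * y + (p / (gamma - 1) + p) * x = y ^+ 2.
    by move: psi0; rewrite /psi -/D -/E -/M -/x -/y y2 /x; lra.
  transitivity ((D * y + (p / (gamma - 1) + p) * x) * x / y ^+ 2).
    rewrite /enthalpy /internal_energy /rho; field.
    by rewrite !gt_eqF ?subr_gt0.
  by rewrite key; field; rewrite gt_eqF.
have eta (V : cons_state R d) :
  V = ConsState (density V) (momentum V) (energy V) by case: V.
by rewrite /v scalerA divff ?gt_eqF// scale1r /x addrK; exact: eta.
Qed.

(** Whichever triple [xget] selects, its pressure is a positive root of [psi], and there is only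
    one. *)
Lemma pressure_unique_root p : 0 < p -> psi gamma U p = 0 ->
  pressure gamma U = p.
Proof.
move=> p0 psi0; rewrite /pressure.
have := xgetPex (0, 0, 0) (prim_exists p p0 psi0).
case: xget => [[rho v] p'] /= prim'; have psi0' := psi_of_prim _ _ _ prim'.
case: prim' => _ p'0 _ _.
exact: (F_root_unique _ _ _ _ _ inv_gamma1_ge1 adm_density_gt0
  (sqnorm_ge0 _ _ _) adm_energy_gt0 adm_energy_sqr p' p (ltW p'0) (ltW p0)
  psi0' psi0).
Qed.

(** [p_c_u] is the larger root of the quadratic obtained from [psi] by freezing its square root at p
    = 0. The constant term, a positive multiple of psi 0 = - s (s - D), is nonpositive because s >=
    D. *)
Lemma p_c_u_ge0 : 0 <= p_c_u gamma U.
Proof.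
have /andP[g1 g2] := gamma12.
rewrite /p_c_u divr_ge0// -/D -/E -/M.
pose g := (2 - gamma) * E.
have g0 : 0 <= g by rewrite mulr_ge0 ?subr_ge0 ?(ltW adm_energy_gt0).
have -> : (gamma - 2) * E = - g by rewrite /g; ring.
rewrite addrC subr_ge0 -[leLHS](ger0_norm g0) -sqrtr_sqr ler_wsqrtr//.
rewrite -exprMn -/g lerDl oppr_ge0 mulr_ge0_le0 ?mulr_ge0 ?subr_ge0 ?(ltW g1)//.
have EM0 : 0 <= E ^+ 2 - M.
  by have := adm_energy_sqr; have := sqr_ge0 D; lra.
set s := Num.sqrt _.
have Ds : D <= s.
  rewrite -(ger0_norm (ltW adm_density_gt0)) -sqrtr_sqr ler_wsqrtr// lerBrDr.
  exact: ltW adm_energy_sqr.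
rewrite -opprB -(sqr_sqrtr EM0) -/s addrC subr_le0 expr2 ler_wpM2r//.
exact: sqrtr_ge0.
Qed.

End Pressure.

Theorem theorem2p10 (R : realType) (d : nat) (gamma : R) (U : cons_state R d)
    (hd : (1 <= d)%N) (hgamma : 1 < gamma <= 2) (hU : admissible U) :
  [/\ forall n : nat, (1 <= n)%N -> 0 < NR2 gamma U n,
      NR2 gamma U @ \oo --> pressure gamma U &
      quadratic_cvg (NR2 gamma U) (pressure gamma U)].
Proof.
have a1 := inv_gamma1_ge1 _ _ hgamma.
have D0 := adm_density_gt0 _ _ _ hU.
have M0 := sqnorm_ge0 _ _ (momentum U).
have E0 := adm_energy_gt0 _ _ _ hU.
have DME := adm_energy_sqr _ _ _ hU.
have [q q0 psiq] := F_has_root _ _ _ _ _ a1 D0 M0 E0 DME.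
rewrite -/(psi gamma U _) in psiq.
rewrite (pressure_unique_root _ _ _ _ hgamma hU q q0 psiq).
set u := NR2 gamma U.
have u_step n : 0 <= u n ->
    u n.+1 = u n - psi gamma U (u n) / derive1 (psi gamma U) (u n).
  by rewrite /u /NR2 /newton iterS.
have dpsi p : 0 <= p -> derive1 (psi gamma U) p = _ :=
  derive1_F _ (gamma - 1)^-1 _ _ _ D0 E0 DME p.
(* Nonnegative iterates make [derive1] agree with [F'], so that [newton_cvg] applies. *)
suff pos n : 0 <= u n /\ 0 < u n.+1.
  have quad : quadratic_cvg u q.
    apply: (newton_cvg _ _ _ _ _ a1 D0 M0 E0 DME q u (ltW q0) psiq).
      by move=> n; have [] := pos n.
    by move=> n; have [un0 _] := pos n; rewrite u_step// dpsi.
  by split=> //; [case=> // n _; have [] := pos n | case: quad].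
(* The same test as in [NR2_init]: start at 0, or at [p_c_u] with every step from p >= 0
   positive. *)
have [dens|dens] := lerP ((energy U ^+ 2 - sqnorm (momentum U)) / energy U)
  (density U).
  have u0 : u 0%N = 0 by rewrite /u /NR2 /newton/= /NR2_init dens.
  apply: (newton_pos_from0 _ _ _ _ _ a1 D0 M0 E0 DME q u q0 psiq u0) => k uk0.
  by rewrite u_step// dpsi.
have u0 : 0 <= u 0%N.
  by rewrite /u /NR2 /newton/= /NR2_init (lt_geF dens) p_c_u_ge0.
have npos k : 0 <= u k -> 0 < u k.+1.
  move=> uk0; rewrite u_step// dpsi//.
  apply: (newton_pos_of_density_lt _ _ _ _ _ a1 D0 M0 E0 DME) => //.
  by move: dens; rewrite ltr_pdivlMr.
elim: n => [|n [_ un1]]; first by split=> //; exact: npos.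
by split; [exact: ltW | apply: npos; exact: ltW].
Qed.
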